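(* Let $\mathbf R$ be a partially ordered set with maximum $1$, let $P\subseteq R$ with $1\in P$, and let $\mathbf P$ be the induced poset on $P$. If $a\in R$ and there exists a smallest element $c\in P$ such that $a\leq c$, then $a$ is a $P$-non-generator in $\mathbf R$ if and only if $c$ is a non-generator in $\mathbf P$.
   Context: Let $\mathbf R$ be a poset with maximum $1$ and $P\subseteq R$ with $1\in P$. No further assumption is made on the induced poset $\mathbf P$ (for example, it need not be a semilattice). A subset $Y\subseteq R$ $P$-generates $1$ if there is no $b\in P$ such that $b<1$ and $y\leq b$ for every $y\in Y$. An element $a\in R$ is a $P$-non-generator in $\mathbf R$ if, for every $e\in R$, if $\{a,e\}$ $P$-generates $1$, then $\{e\}$ $P$-generates $1$. In the poset $\mathbf P$ (with maximum $1$), for $c,d\in P$, ''$c\vee d=1$'' means that there is no $p\in P$ such that $p<1$, $c\leq p$ and $d\leq p$; an element $c\in P$ is a non-generator in $\mathbf P$ if, for every $d\in P$, $c\vee d=1$ implies $d=1$. *)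

(* Defs.v *)
From HB Require Import structures.
From mathcomp Require Import all_boot all_order.
From mathcomp Require Import boolp classical_sets.

Set Implicit Arguments.
Unset Strict Implicit.
Unset Printing Implicit Defensive.

Import Order.TTheory.

Local Open Scope classical_set_scope.
Local Open Scope order_scope.

(* The proof that P contains the maximum is a parameter of the type, so that
   the induced poset canonically has a maximum. *)
Definition induced (d : Order.disp_t) (R : tPOrderType d) (P : set R)
  (P1 : P \top) : Type := set_type P.

Section Induced.
Context (d : Order.disp_t) (R : tPOrderType d) (P : set R) (P1 : P \top).

HB.instance Definition _ := SubChoice.on (induced P1).
HB.instance Definition _ := [SubChoice_isSubPOrder of induced P1 by <: with d].

Definition induced_top : induced P1 := SigSub (mem_set P1).

Fact induced_lex1 (x : induced P1) : x <= induced_top.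
Proof. by rewrite -Order.le_val; exact: lex1. Qed.

HB.instance Definition _ :=
  Order.hasTop.Build d (induced P1) induced_lex1.

Fact induced_topE : \val (\top : induced P1) = \top :> R.
Proof. by []. Qed.

Fact induced_leE (x y : induced P1) : (x <= y) = (\val x <= \val y :> R).
Proof. by rewrite Order.le_val. Qed.

End Induced.

Section Relative.
Context (d : Order.disp_t) (R : tPOrderType d).
Implicit Types (P Y : set R) (a : R).

Definition generates_top P Y : Prop :=
  ~ exists b, [/\ P b, b < \top & forall y, Y y -> y <= b].

Definition rel_non_generator P a : Prop :=
  forall e, generates_top P [set a; e] -> generates_top P [set e].

End Relative.

Section Absolute.
Context (d : Order.disp_t) (T : tPOrderType d).
Implicit Types b c : T.

(* "The join of b and c is the maximum", where the join need not exist
   otherwise. *)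
Definition join_is_top b c : Prop :=
  ~ exists p, [/\ p < \top, b <= p & c <= p].

Definition non_generator c : Prop :=
  forall b, join_is_top c b -> b = \top.

End Absolute.

(* Main.v *)
(** Since [c] is the least element of [P] above [a], an element of [P] lies
    above [a] iff it lies above [c]; hence, for [q] in [P], the set [{a, q}]
    [P]-generates the top iff [c] and [q] join to the top in [P]. For the
    converse, an element [b < \top] of [P] above [e] can replace [e]. *)
Require Import Defs.
From mathcomp Require Import all_boot all_order.
From mathcomp Require Import boolp classical_sets.

Import Order.TTheory.

Local Open Scope classical_set_scope.
Local Open Scope order_scope.

Lemma induced_ltE (d : Order.disp_t) (R : tPOrderType d) (P : set R)
    (P1 : P \top) (x y : induced P1) : (x < y) = (\val x < \val y :> R).
Proof. by rewrite !lt_def induced_leE (inj_eq val_inj). Qed.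

Theorem lemma3p1 (d : Order.disp_t) (R : tPOrderType d) (P : set R)
    (P1 : P \top) (a : R) (c : induced P1)
    (le_ac : a <= \val c)
    (c_min : forall q : induced P1, a <= \val q -> c <= q) :
  rel_non_generator P a <-> non_generator c.
Proof.
split=> [nga q cq1 | ngc e gen_ae [b [Pb b1 eb]]].
- have gen_q : generates_top P [set \val q].
    apply: nga => -[b [Pb b1 ub]]; apply: cq1.
    pose b' : induced P1 := SigSub (mem_set Pb).
    exists b'; split; first by rewrite induced_ltE.
      by apply: c_min; apply: ub; left.
    by rewrite induced_leE; apply: ub; right.
  (* If [q] were not the maximum, [\val q] would itself be a bound in [P] refuting [gen_q]. *)
  apply/eqP; apply: contrapT => /negP q1; apply: gen_q.
  exists (\val q); split; first exact: set_mem (valP q).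
    by rewrite -(induced_topE P1) -induced_ltE lt_neqAle q1 lex1.
  by move=> y ->.
- pose b' : induced P1 := SigSub (mem_set Pb).
  (* By conversion [\val b'] is [b] and [\val \top] is [\top], so [b' = \top] contradicts
     [b < \top]. *)
  suff b'1 : b' = \top by move: b1; rewrite -[b]/(\val b') b'1 ltxx.
  (* Some [p < \top] above [c] and [b'] would bound [a] through [c] and [e] through [b], against
     [gen_ae]. *)
  apply: ngc => -[p [p1 cp bp]]; apply: gen_ae.
  exists (\val p); split; first exact: set_mem (valP p).
    by rewrite -(induced_topE P1) -induced_ltE.
  move: cp bp; rewrite !induced_leE => cp bp y [->|->].
    exact: le_trans le_ac cp.
  exact: le_trans (eb e erefl) bp.
Qed.
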